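(* For all integers $n\ge 0$ and all integers $k\ge j\ge 0$, \[ a_{27(k-j)+2,\;27k+4}(27n+9)\equiv a_{27(k-j)+2,\;27k+4}(27n+18)\equiv 0 \pmod 3. \]
   Context: For positive integers $r,s$, $a_{r,s}(n)$ denotes the number of multicolored partitions of $n$ in which each even part may appear in one of $r$ colors and each odd part may appear in one of $s$ colors (copies of the same part size in different colors are distinct), with $a_{r,s}(0)=1$. Equivalently, for $|q|<1$, $\sum_{n\ge0}a_{r,s}(n)q^n = f_2^{s-r}/f_1^{s}$, where $f_m=\prod_{i\ge1}(1-q^{mi})$. *)

(* Defs.v *)
From mathcomp Require Import all_boot.

Set Implicit Arguments.
Unset Strict Implicit.
Unset Printing Implicit Defensive.

Definition ncolors (r s i : nat) : nat := if odd i then s else r.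

(* A pair (i, c) stands for the part i.+1 in the color c, so the sizes range
   over 1, ..., n. *)
Definition colored_part (r s n : nat) : finType :=
  {i : 'I_n & 'I_(ncolors r s i.+1)}.

Definition part_size (r s n : nat) (p : colored_part r s n) : nat :=
  (tag p).+1.

(* A multicolored partition of n is a multiset of colored parts with total n,
   given by its multiplicity function; in a partition of n no part exceeds n
   and no multiplicity exceeds n, so the bounds lose nothing. *)
Definition colored_partitions (r s n : nat) :
    {set {ffun colored_part r s n -> 'I_n.+1}} :=
  [set m : {ffun colored_part r s n -> 'I_n.+1} |
    \sum_(p : colored_part r s n) part_size p * m p == n].

Definition a_ (r s n : nat) : nat := #|colored_partitions r s n|.

(* Main.v *)
(** Write f_m for the product of the 1 - q^(m i) and theta = f_1^2 / f_2, which by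
    Gauss equals 1 + 2 sum_(s >= 1) (-1)^s q^(s^2).  Modulo 3, cubing a series
    replaces q by q^3, so the generating function f_2^(27 j + 2) / f_1^(27 k + 4)
    is theta^(-2) times a series in q^27, hence also theta^25 times a series in
    q^27.  Squares are 0 or 1 modulo 3, so theta = theta^9 + q T^3 modulo 3;
    extracting the exponents divisible by 3 twice from theta^25 leaves theta^9,
    a series in q^3, so only exponents divisible by 27 survive among the
    multiples of 9. *)
Require Import Defs.
From mathcomp Require Import all_boot all_algebra.
From mathcomp Require Import ring zify.

Import GRing.Theory.
Local Open Scope ring_scope.

(** * A finite form of Gauss's identity for theta *)

Section GaussIdentity.
Variable R : comNzRingType.

Definition theta (n : nat) : {poly R} :=
  1 + 2 * \sum_(0 <= s < n) (-1) ^+ s.+1 * 'X^(s.+1 ^ 2).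

Definition euler (a n : nat) : {poly R} := \prod_(a <= i < n) (1 - 'X^(i.+1)).

(* Generating function of the partitions into distinct parts at most n. *)
Definition distinct (n : nat) : {poly R} := \prod_(0 <= i < n) (1 + 'X^(i.+1)).

Lemma thetaS n : theta n.+1 = theta n + 2 * ((-1) ^+ n.+1 * 'X^(n.+1 ^ 2)).
Proof. by rewrite /theta big_nat_recr //= mulrDr addrA. Qed.

Lemma distinctS n : distinct n.+1 = distinct n * (1 + 'X^(n.+1)).
Proof. exact: big_nat_recr. Qed.

Lemma euler_recr a n : (a <= n)%N -> euler a n.+1 = euler a n * (1 - 'X^(n.+1)).
Proof. exact: big_nat_recr. Qed.

Lemma euler_recl a n : (a < n)%N -> euler a n = (1 - 'X^(a.+1)) * euler a.+1 n.
Proof. exact: big_ltn. Qed.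

Lemma euler_id n : euler n n = 1.
Proof. by rewrite /euler big_geq. Qed.

(** The factor [1 + 'X^(n.+1)] is what [distinct] gains from [n] to [n.+1], so the case [m = n]
    drives the induction in Gauss's identity. Leaving [m] free exposes the telescoping in [s]. *)
Lemma theta_distinct_telescope (n m : nat) : (m <= n)%N ->
  \sum_(0 <= s < m) (-1) ^+ s.+1 * 'X^(s.+1 * n.+2) * distinct s * euler s.+1 n.+1
  - (1 + 'X^(n.+1)) *
    \sum_(0 <= s < m) (-1) ^+ s.+1 * 'X^(s.+1 * n.+1) * distinct s * euler s.+1 n
  = 'X^(n.+1) * euler 0 n - (-1) ^+ m * 'X^(m.+1 * n.+1) * distinct m * euler m n.
Proof.
elim: m => [|m IHm] lemn; first by rewrite !big_nil mul1n /distinct big_nil; ring.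
rewrite !big_nat_recr //= mulrDr opprD addrACA {}IHm ?(ltnW lemn) //.
rewrite distinctS euler_recr // [euler m n]euler_recl //.
rewrite (_ : m.+1 * n.+2 = m.+1 * n.+1 + m.+1)%N; last by lia.
rewrite (_ : m.+2 * n.+1 = m.+1 * n.+1 + n.+1)%N; last by lia.
by rewrite !exprD !exprS; ring.
Qed.

(* A finite form of Gauss's identity, in the style of Shanks: the sum on the
   right vanishes modulo X^n.+1. *)
Lemma theta_distinct (n : nat) :
  theta n * distinct n = euler 0 n +
    2 * \sum_(0 <= s < n) (-1) ^+ s.+1 * 'X^(s.+1 * n.+1) * distinct s * euler s.+1 n.
Proof.
elim: n => [|n IHn]; first by rewrite /theta /distinct /euler !big_nil; ring.
have tel := @theta_distinct_telescope n n (leqnn n).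
rewrite euler_id mulr1 in tel.
rewrite thetaS mulrDl distinctS [theta n * _]mulrA IHn big_nat_recr //= euler_id.
rewrite euler_recr //; move/eqP: tel; rewrite subr_eq => /eqP ->.
rewrite (_ : n.+1 ^ 2 = n.+1 * n.+1)%N //.
rewrite (_ : n.+1 * n.+2 = n.+1 * n.+1 + n.+1)%N; last by lia.
by rewrite !exprD !exprS; ring.
Qed.

End GaussIdentity.

(** * Generating polynomial of the colored partitions *)

Section GeneratingFunction.
Variable R : comNzRingType.

Definition partition_poly (r s n : nat) : {poly R} :=
  \prod_(i < n) (\sum_(e < n.+1) 'X^(i.+1) ^+ e) ^+ ncolors r s i.+1.

(** Once each power is a product over colors, distributing chooses one exponent per colored part,
    which is exactly a multiplicity function. *)
Lemma coef_partition_poly (r s n : nat) :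
  (partition_poly r s n)`_n = (a_ r s n)%:R.
Proof.
have -> : partition_poly r s n =
    \sum_(m : {ffun colored_part r s n -> 'I_n.+1})
      'X^(\sum_(p : colored_part r s n) part_size p * m p).
  rewrite /partition_poly.
  under eq_bigr => i _ do rewrite -[ncolors r s i.+1]card_ord -prodr_const.
  rewrite (sig_big_dep _ _ (fun (i : 'I_n) (c : 'I_(ncolors r s i.+1)) =>
      \sum_(e < n.+1) 'X^(i.+1) ^+ e : {poly R})) /=.
  rewrite bigA_distr_bigA /=; apply: eq_bigr => m _.
  rewrite (big_morph (GRing.exp 'X) (exprD 'X) (expr0 'X)).
  by apply: eq_bigr => p _; rewrite exprM.
rewrite coef_sum /a_ -sum1_card natr_sum [RHS]big_mkcond /=.
by apply: eq_bigr => m _; rewrite coefXn inE eq_sym; case: eqP.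
Qed.

End GeneratingFunction.

(** * Congruence modulo X^n, standing in for power series *)

Section Truncation.
Variable F : fieldType.
Implicit Types p q : {poly F}.

Definition eq_trunc (n : nat) p q : bool := 'X^n %| p - q.

Lemma eq_trunc_refl n p : eq_trunc n p p.
Proof. by rewrite /eq_trunc subrr dvdp0. Qed.

Lemma eq_trunc_sym n p q : eq_trunc n p q -> eq_trunc n q p.
Proof. by rewrite /eq_trunc -opprB dvdpNr. Qed.

Lemma eq_trunc_trans n q p r : eq_trunc n p q -> eq_trunc n q r -> eq_trunc n p r.
Proof.
by rewrite /eq_trunc -[p - r](subrKA q) => npq nqr; rewrite dvdp_add.
Qed.

Lemma eq_truncM n p p' q q' :
  eq_trunc n p p' -> eq_trunc n q q' -> eq_trunc n (p * q) (p' * q').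
Proof.
rewrite /eq_trunc => npp nqq.
have -> : p * q - p' * q' = (p - p') * q + p' * (q - q') by ring.
by apply: dvdp_add; [apply: dvdp_mulr | apply: dvdp_mull].
Qed.

Lemma eq_truncX n m p q : eq_trunc n p q -> eq_trunc n (p ^+ m) (q ^+ m).
Proof.
move=> npq; elim: m => [|m IHm]; first exact: eq_trunc_refl.
by rewrite !exprS eq_truncM.
Qed.

Lemma eq_trunc_prod1 (I : Type) (s : seq I) (P : pred I) (f : I -> {poly F}) n :
  (forall i, P i -> eq_trunc n (f i) 1) -> eq_trunc n (\prod_(i <- s | P i) f i) 1.
Proof.
move=> f1; apply: (big_ind (fun p => eq_trunc n p 1)) => //.
  exact: eq_trunc_refl.
by move=> p q p1 q1; rewrite -[1]mulr1 eq_truncM.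
Qed.

Lemma eq_trunc_coef n i p q : (i < n)%N -> eq_trunc n p q -> p`_i = q`_i.
Proof.
move=> lt_in /dvdpP[r /(congr1 (fun u : {poly F} => u`_i))].
by rewrite coefB coefMXn lt_in => /subr0_eq.
Qed.

(** A nonzero constant term makes [r] coprime to X^n. *)
Lemma eq_trunc_cancel n p q r :
  ~~ root r 0 -> eq_trunc n (r * p) (r * q) -> eq_trunc n p q.
Proof.
move=> r0; rewrite /eq_trunc -mulrBr Gauss_dvdpr // coprimep_expl //.
by rewrite coprimep_sym coprimepX.
Qed.

Lemma eq_trunc_oneBXn n m : (n <= m)%N -> eq_trunc n (1 - 'X^m) 1.
Proof.
by move=> lenm; rewrite /eq_trunc addrC addKr dvdpNr dvdp_exp2l.
Qed.

End Truncation.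

(** * Cubes and trisection over F_3 *)

Section Trisection.
Implicit Types p q : {poly 'F_3}.

Lemma three_eq0 : 3 = 0 :> {poly 'F_3}.
Proof. by rewrite -polyC_natr pchar_Fp_0. Qed.

Lemma cubeD p q : (p + q) ^+ 3 = p ^+ 3 + q ^+ 3.
Proof.
have -> : (p + q) ^+ 3 = p ^+ 3 + q ^+ 3 + 3 * (p ^+ 2 * q + p * q ^+ 2) by ring.
by rewrite three_eq0 mul0r addr0.
Qed.

Lemma cube_polyC (c : 'F_3) : (c%:P) ^+ 3 = c%:P.
Proof. by rewrite -polyC_exp; congr polyC; apply/eqP; case: c => [[|[|[|]]]]. Qed.

(** Frobenius: cubing is additive and fixes the constants of F_3, so p^3 = p(X^3). *)
Lemma coef_cube p i : (p ^+ 3)`_i = if (3 %| i)%N then p`_(i %/ 3) else 0.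
Proof.
rewrite -(coef_comp_poly_Xn p) //; suff -> : p ^+ 3 = p \Po 'X^3 by [].
elim/poly_ind: p => [|p c IHp]; first by rewrite comp_poly0 expr0n.
by rewrite cubeD exprMn IHp cube_polyC comp_poly_MXaddC.
Qed.

(* The polynomial theta^9 is theta(X^9), the part of theta indexed by the multiples
   of 3, whence the factor 3 between the two truncation orders. *)
Lemma theta_trisection n : exists T : {poly 'F_3},
  theta 'F_3 (3 * n) = theta 'F_3 n ^+ 9 + 'X * T ^+ 3.
Proof.
elim: n => [|n [T IHn]].
  by exists 0; rewrite /theta !big_nil mulr0 addr0 !expr1n expr0n mulr0 addr0.
(* X u^3 and X v^3 are the theta terms of index 3n+1 and 3n+2, whose squares are 1 modulo 3. The
   term of index 3n+3 goes into the ninth power. *)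
pose u : {poly 'F_3} := 2 * ((-1) ^+ (3 * n).+1 * 'X^(3 * n ^ 2 + 2 * n)).
pose v : {poly 'F_3} := 2 * ((-1) ^+ (3 * n).+2 * 'X^(3 * n ^ 2 + 4 * n + 1)).
exists (T + u + v).
have cube_term m a : (2 * ((-1) ^+ m * 'X^a) : {poly 'F_3}) ^+ 3 =
    2 * ((-1) ^+ m * 'X^(a * 3)).
  rewrite 2!exprMn -(exprM 'X) (exprAC _ m 3) (_ : (-1) ^+ 3 = -1); last by ring.
  rewrite (_ : 2 ^+ 3 = 2 + 3 * 2); last by ring.
  by rewrite three_eq0 mul0r addr0.
rewrite (_ : 3 * n.+1 = (3 * n).+3)%N; last by lia.
rewrite !thetaS IHn (cubeD (T + u)) (cubeD T) /u /v !cube_term.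
rewrite [in RHS](exprM _ 3 3) cubeD cube_term cubeD cube_term -exprM.
rewrite (_ : (3 * n).+1 ^ 2 = (3 * n ^ 2 + 2 * n) * 3 + 1)%N; last by lia.
rewrite (_ : (3 * n).+2 ^ 2 = (3 * n ^ 2 + 4 * n + 1) * 3 + 1)%N; last by lia.
rewrite (_ : (3 * n).+3 ^ 2 = n.+1 ^ 2 * 3 * 3)%N; last by lia.
rewrite (_ : (-1) ^+ (3 * n).+3 = (-1) ^+ n.+1); last first.
  by rewrite -signr_odd -[RHS]signr_odd; congr (_ ^+ (nat_of_bool _)); lia.
rewrite !(exprD _ (_ * 3) 1) expr1; move: (theta _ n) => t.
by ring.
Qed.

(** The operator U_3 on q-series: X^(3i) becomes X^i and the other powers vanish. *)
Definition trisect p : {poly 'F_3} := \poly_(i < size p) p`_(3 * i).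

Lemma coef_trisect p i : (trisect p)`_i = p`_(3 * i).
Proof.
rewrite coef_poly; case: ltnP => // le_pi.
by rewrite nth_default // (leq_trans le_pi) // leq_pmull.
Qed.

Lemma trisectD p q : trisect (p + q) = trisect p + trisect q.
Proof. by apply/polyP => i; rewrite !(coef_trisect, coefD). Qed.

(** All exponents of q^3 = q(X^3) are multiples of 3, so this factor passes through the operator and
    comes out as q. *)
Lemma trisect_cubel p q : trisect (q ^+ 3 * p) = q * trisect p.
Proof.
elim/poly_ind: q p => [|q c IHq] p.
  by apply/polyP => i; rewrite exprS !mul0r coef_trisect !coef0.
rewrite cubeD cube_polyC exprMn !mulrDl trisectD -[q ^+ 3 * _ * _]mulrA -mulrA IHq.
congr (q * _ + _).
  apply/polyP => i; rewrite coef_trisect coefXnM coefXM coef_trisect.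
  by case: i => // i; rewrite mulnS /= addKn.
by apply/polyP => i; rewrite coef_trisect !coefCM coef_trisect.
Qed.

Lemma trisect1 : trisect 1 = 1.
Proof. by apply/polyP => i; rewrite coef_trisect !coef1; case: i. Qed.

Lemma trisectX : trisect 'X = 0.
Proof. by apply/polyP => i; rewrite coef_trisect coefX coef0; case: eqP => //; lia. Qed.

Lemma trisectX2 : trisect 'X^2 = 0.
Proof. by apply/polyP => i; rewrite coef_trisect coefXn coef0; case: eqP => //; lia. Qed.

Lemma trisect2_theta_power (A T Z : {poly 'F_3}) :
  trisect (trisect ((A ^+ 9 + 'X * T ^+ 3) ^+ 7 * A ^+ 18 * Z ^+ 27)) =
  (A ^+ 3 * Z) ^+ 3.
Proof.
set B := A ^+ 9 + _; have defB : B = A ^+ 9 + 'X * T ^+ 3 by [].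
(* Six of the seven factors [B] form the cube of B^2; only the seventh is expanded. *)
have -> : B ^+ 7 * A ^+ 18 * Z ^+ 27 =
    (B ^+ 2 * A ^+ 9 * Z ^+ 9) ^+ 3 * 1 + (B ^+ 2 * A ^+ 6 * T * Z ^+ 9) ^+ 3 * 'X.
  by rewrite exprSr {2}defB; ring.
rewrite trisectD !trisect_cubel trisectX mulr0 addr0 trisect1 mulr1.
(* Now B^2 is expanded. The cube of 2 is 8, and the subtracted multiple of 3 restores the cross
   coefficient 2. *)
have -> : B ^+ 2 * A ^+ 9 * Z ^+ 9 = (A ^+ 9 * Z ^+ 3) ^+ 3 * 1
    + (2 * A ^+ 6 * T * Z ^+ 3) ^+ 3 * 'X + (T ^+ 2 * A ^+ 3 * Z ^+ 3) ^+ 3 * 'X^2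
    - 3 * (2 * A ^+ 18 * T ^+ 3 * Z ^+ 9 * 'X).
  by rewrite /B; ring.
rewrite three_eq0 mul0r subr0 !trisectD !trisect_cubel trisect1 trisectX trisectX2.
by ring.
Qed.

Lemma coef_theta_power (A T Z : {poly 'F_3}) (i : nat) : ~~ (3 %| i)%N ->
  ((A ^+ 9 + 'X * T ^+ 3) ^+ 7 * A ^+ 18 * Z ^+ 27)`_(9 * i) = 0.
Proof.
move=> i3; rewrite -[9%N]/(3 * 3)%N -mulnA -!coef_trisect trisect2_theta_power.
by rewrite coef_cube (negPf i3).
Qed.

End Trisection.

(** * Products over even and odd parts, and their relation to theta *)

Section EvenOddProducts.
Variable F : fieldType.

(* The index i stands for the factor of the part i.+1, so odd i is an even part. *)
Definition even_euler (n : nat) : {poly F} :=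
  \prod_(0 <= i < n | odd i) (1 - 'X^(i.+1)).

Definition odd_euler (n : nat) : {poly F} :=
  \prod_(0 <= i < n | ~~ odd i) (1 - 'X^(i.+1)).

Lemma euler_even_odd n : euler F 0 n = even_euler n * odd_euler n.
Proof. exact: bigID. Qed.

Lemma even_euler_unit n : ~~ root (even_euler n) 0.
Proof.
rewrite /root /even_euler horner_prod big1 ?oner_neq0 // => i _.
by rewrite hornerD hornerN hornerXn hornerC expr0n subr0.
Qed.

Lemma euler_distinct n : euler F 0 n * distinct F n = even_euler n.*2.
Proof.
elim: n => [|n IHn]; first by rewrite /euler /distinct /even_euler !big_nil mulr1.
rewrite euler_recr // distinctS doubleS /even_euler !big_mkcond !big_nat_recr //=.
rewrite -!big_mkcond -/(even_euler _) -IHn odd_double /= mulr1.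
by rewrite -doubleS -addnn exprD; ring.
Qed.

Lemma even_euler_double_trunc n : eq_trunc F n.+1 (even_euler n.*2) (even_euler n).
Proof.
have le_n2n : (n <= n.*2)%N by rewrite -addnn leq_addr.
rewrite /even_euler (big_cat_nat (leq0n n) le_n2n) /=.
rewrite -[X in eq_trunc _ _ _ X]mulr1; apply: eq_truncM; first exact: eq_trunc_refl.
rewrite big_nat_cond; apply: eq_trunc_prod1 => i /andP[/andP[le_ni _] _].
exact: eq_trunc_oneBXn.
Qed.

Lemma theta_distinct_trunc n :
  eq_trunc F n.+1 (theta F n * distinct F n) (euler F 0 n).
Proof.
rewrite theta_distinct /eq_trunc addrC addKr; apply: dvdp_mull.
apply: (big_ind (fun p : {poly F} => 'X^(n.+1) %| p)) => [|p q|s _];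
  [exact: dvdp0 | exact: dvdp_add |].
rewrite -mulrA; apply: dvdp_mulr; apply: dvdp_mull.
by rewrite dvdp_exp2l // leq_pmull.
Qed.

Lemma theta_stable n m : (n <= m)%N -> eq_trunc F n.+1 (theta F m) (theta F n).
Proof.
move=> /subnK <-; elim: (m - n)%N => [|d IHd]; first exact: eq_trunc_refl.
apply: eq_trunc_trans IHd; rewrite addSn thetaS /eq_trunc addrC addKr.
do 2![apply: dvdp_mull]; rewrite dvdp_exp2l //.
by rewrite (leq_trans _ (leq_pmulr _ _)) // ltnS leq_addl.
Qed.

(** With E and O the even and odd products, f_1 = E O and f_2 = E, so E O^2 is f_1^2 / f_2. *)
Lemma theta_trunc n :
  eq_trunc F n.+1 (even_euler n * odd_euler n ^+ 2) (theta F n).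
Proof.
(* Euler's theorem on distinct and odd parts, obtained by cancelling the even product. *)
have odd_distinct : eq_trunc F n.+1 (odd_euler n * distinct F n) 1.
  apply: (eq_trunc_cancel _ _ _ _ _ (even_euler_unit n)).
  rewrite mulrA -euler_even_odd euler_distinct mulr1.
  exact: even_euler_double_trunc.
apply: eq_trunc_sym.
apply: (@eq_trunc_trans _ _ (theta F n * distinct F n * odd_euler n)).
  rewrite -mulrA [distinct F n * _]mulrC -[X in eq_trunc _ _ X _]mulr1.
  by apply: eq_truncM; [exact: eq_trunc_refl | exact: eq_trunc_sym].
rewrite expr2 mulrA -euler_even_odd.
by apply: eq_truncM; [exact: theta_distinct_trunc | exact: eq_trunc_refl].
Qed.

(** Each geometric sum times its factor is 1 - X^((i+1)(n+1)), which is 1 to this order. *)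
Lemma partition_poly_inverse r s n :
  eq_trunc F n.+1
    (partition_poly F r s n * (even_euler n ^+ r * odd_euler n ^+ s)) 1.
Proof.
have -> : even_euler n ^+ r * odd_euler n ^+ s =
    \prod_(i < n) (1 - 'X^(i.+1)) ^+ ncolors r s i.+1.
  rewrite /even_euler /odd_euler -!prodrXl !big_mkord.
  rewrite [RHS](bigID (fun i : 'I_n => odd i)) /=; congr (_ * _).
    by apply: eq_bigr => i oddi; rewrite /ncolors /= oddi.
  by apply: eq_bigr => i oddi; rewrite /ncolors /= oddi.
rewrite -big_split /=; apply: eq_trunc_prod1 => i _; rewrite -exprMn.
rewrite -[X in eq_trunc _ _ _ X](expr1n _ (ncolors r s i.+1)); apply: eq_truncX.
have -> : (\sum_(e < n.+1) 'X^(i.+1) ^+ e) * (1 - 'X^(i.+1)) =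
    1 - 'X^(i.+1 * n.+1) :> {poly F}.
  by rewrite exprM -[1 - 'X^(i.+1)]opprB mulrN mulrC -subrX1 opprB.
by apply: eq_trunc_oneBXn; rewrite leq_pmull.
Qed.

End EvenOddProducts.

(** * Reduction to theta^25 and the congruences *)

Lemma partition_poly_theta_power (r s n : nat) : exists T Z : {poly 'F_3},
  eq_trunc 'F_3 n.+1 (partition_poly 'F_3 (27 * r + 2) (27 * s + 4) n)
    ((theta 'F_3 n ^+ 9 + 'X * T ^+ 3) ^+ 7 * theta 'F_3 n ^+ 18 * Z ^+ 27).
Proof.
have [T defT] := theta_trisection n; exists T; rewrite -defT.
have theta3 : eq_trunc 'F_3 n.+1 (theta 'F_3 (3 * n)) (theta 'F_3 n).
  by apply: theta_stable; rewrite leq_pmull.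
have thetaU := theta_trunc 'F_3 n.
have := partition_poly_inverse 'F_3 (27 * r + 2) (27 * s + 4) n.
set G := partition_poly _ _ _ _; set U := (X in eq_trunc _ _ X _) in thetaU.
pose W := even_euler 'F_3 n ^+ r * odd_euler 'F_3 n ^+ s.
have -> : even_euler 'F_3 n ^+ (27 * r + 2) * odd_euler 'F_3 n ^+ (27 * s + 4) =
    U ^+ 2 * W ^+ 27.
  rewrite (exprD _ (27 * r)) (exprD _ (27 * s)) !(mulnC 27) (exprM _ r) (exprM _ s).
  by rewrite /U /W; ring.
(* [Z] inverts U W to this order: U W Z is the square of G U^2 W^27, which is congruent to 1. *)
move=> GUW; pose Z := G * U * W ^+ 26 * (G * U ^+ 2 * W ^+ 27); exists Z.
have UWZ : eq_trunc 'F_3 n.+1 (U * W * Z) 1.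
  have -> : U * W * Z = (G * (U ^+ 2 * W ^+ 27)) ^+ 2 by rewrite /Z; ring.
  by rewrite -(expr1n _ 2); apply: eq_truncX.
apply: (@eq_trunc_trans _ _ (G * (U * W * Z) ^+ 27)).
  rewrite -[X in eq_trunc _ _ X _]mulr1 -[in X in eq_trunc _ _ X _](expr1n _ 27).
  apply: eq_truncM; first exact: eq_trunc_refl.
  exact/eq_truncX/eq_trunc_sym.
(* This trades theta^(-2) for theta^25. Seven copies of [U] then become theta cut at 3n, ready for
   trisection, and eighteen become theta cut at n. *)
have -> : G * (U * W * Z) ^+ 27 = G * (U ^+ 2 * W ^+ 27) * (U ^+ 7 * U ^+ 18 * Z ^+ 27).
  by move: Z {UWZ} => Z; ring.
rewrite -[X in eq_trunc _ _ _ X]mul1r; apply: eq_truncM => //.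
apply: eq_truncM; last exact: eq_trunc_refl.
apply: eq_truncM; apply: eq_truncX => //.
exact: eq_trunc_trans _ _ _ _ _ thetaU (eq_trunc_sym _ _ _ _ theta3).
Qed.

Lemma a_mod3 (r s m : nat) : ~~ (3 %| m)%N ->
  a_ (27 * r + 2) (27 * s + 4) (9 * m) = 0 %[mod 3].
Proof.
move=> m3.
have [T [Z /(eq_trunc_coef _ _ _ _ _ (ltnSn _))]] :=
  partition_poly_theta_power r s (9 * m).
rewrite coef_partition_poly coef_theta_power // => /(congr1 val).
by rewrite /= val_Fp_nat.
Qed.

Local Close Scope ring_scope.

Theorem theorem1p7 (n k j : nat) (hjk : j <= k) :
  a_ (27 * (k - j) + 2) (27 * k + 4) (27 * n + 9) = 0 %[mod 3] /\
  a_ (27 * (k - j) + 2) (27 * k + 4) (27 * n + 18) = 0 %[mod 3].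
Proof.
have -> : (27 * n + 9 = 9 * (3 * n + 1))%N by lia.
have -> : (27 * n + 18 = 9 * (3 * n + 2))%N by lia.
by split; apply: a_mod3; lia.
Qed.
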